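(* Let $G$ be a finite group. (a) Let $Q$ be a $2$-subgroup of $G$. Then $Q$ is a perfect code of $G$ if and only if it is a perfect code of every Sylow $2$-subgroup of $G$ which contains $Q$. (b) Let $P$ be a Sylow $2$-subgroup of $G$ and $Q$ a normal subgroup of $P$. Then $Q$ is a perfect code of $G$ if and only if it is a perfect code of $P$.
   Context: For a finite group $G$ with identity $1$ and a subset $S\subseteq G\setminus\{1\}$ with $S^{-1}=S$ (possibly $S=\emptyset$), the Cayley graph $\mathrm{Cay}(G,S)$ has vertex set $G$, with $x,y$ adjacent if and only if $yx^{-1}\in S$. A perfect code in a graph $\Gamma$ with vertex set $V$ is a subset $C\subseteq V$ such that no two vertices of $C$ are adjacent and every vertex in $V\setminus C$ is adjacent to exactly one vertex in $C$. A subset (in particular a subgroup) $C$ of $G$ is called a perfect code of $G$ if there exists such an $S$ for which $C$ is a perfect code in $\mathrm{Cay}(G,S)$. A $2$-subgroup is a subgroup whose order is a power of $2$. *)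

(* Defs.v *)
From mathcomp Require Import all_boot all_fingroup all_solvable.

Set Implicit Arguments.
Unset Strict Implicit.
Unset Printing Implicit Defensive.

Import GroupScope.

(* A graph is given by a vertex set V and an adjacency relation e on the
   ambient finite type; only the edges between vertices of V matter. *)
Definition graph_perfect_code (T : finType) (V : {set T}) (e : rel T)
    (C : {set T}) : Prop :=
  [/\ C \subset V,
      forall x y, x \in C -> y \in C -> ~~ e x y
    & forall v, v \in V :\: C -> exists! c, c \in C /\ e v c].

Definition connection_set (gT : finGroupType) (G S : {set gT}) : Prop :=
  S \subset G^# /\ S^-1 = S.

Definition Cayley_adj (gT : finGroupType) (S : {set gT}) : rel gT :=
  fun x y => y * x^-1 \in S.

(* The vertex set is the group G itself, so "perfect code of P" for a
   subgroup P of G refers to Cayley graphs of P, not of G. *)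
Definition perfect_code_of (gT : finGroupType) (G : {group gT})
    (C : {set gT}) : Prop :=
  exists S : {set gT},
    connection_set G S /\ graph_perfect_code G (Cayley_adj S) C.

(* Main.v *)
Require Import Defs.
From mathcomp Require Import all_boot all_fingroup all_solvable.

(** Let [Q] be a 2-subgroup of [G].  A connection set for which [Q] is a perfect
    code is the same thing as an inverse-closed set [S] of representatives of
    the right cosets of [Q] in [G] other than [Q] itself: the neighbours of [v]
    in [Q] are the [c] with [c * v^-1 \in S], so they correspond to the elements
    of [S] in the coset [Q :* v^-1].

    The point is a local criterion ([perfect_code_2groupP]): such an [S] exists
    if and only if each [x] in the normaliser of [Q] in [G] with [x ^+ 2 \in Q]
    has an element of square 1 in its coset, that is, involutions of
    ['N_G(Q) / Q] lift.

    Necessity: if [x] is outside [Q], the coset [Q :* x] is closed under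
    inversion, so the single element of [S] in it is its own inverse.

    Sufficiency: take an inverse-closed partial transversal [S] of maximal size,
    and suppose that it misses the coset of [x].  Put [D = QxQ].  Any coset in
    [D] meets the inverse of any coset in [D^-1], so a second missed coset, in
    [D^-1], would allow a pair [z, z^-1] to be added to [S].  As [S] has as many
    elements in [D] as in [D^-1], it follows that [D = D^-1] and that [Q :* x]
    is the only missed coset in [D].  Moreover [S :&: D] contains no [y] with
    [y^-1 = y], since removing [y] and then pairing the coset of [x] with that
    of [y] would enlarge [S].  Hence [S :&: D] has even size, so [D] consists of
    an odd number of cosets.  That number divides [#|Q|], a power of 2, so it is
    1: then [x] normalises [Q] and [x ^+ 2 \in Q], and the lifting condition
    provides an element of square 1 with which to extend [S].

    Perfect codes restrict to intermediate subgroups ([perfect_code_sub]), so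
    only the passage from Sylow subgroups to [G] needs the criterion, which
    involves just the 2-subgroups generated by [Q] and one element [x].  By
    Sylow's theorem such a subgroup lies in a Sylow 2-subgroup of [G], which
    gives (a).  If [Q] is normal in the Sylow subgroup [P], then [P] is also
    Sylow in ['N_G(Q)], so [x] can be moved into [P] by a conjugation that fixes
    [Q], which gives (b). *)

Set Implicit Arguments.
Unset Strict Implicit.
Unset Printing Implicit Defensive.

Import GroupScope.

(** * Inverse-closed partial transversals *)

Definition involutions_lift (gT : finGroupType) (G Q : {group gT}) : Prop :=
  forall x, x \in 'N_G(Q) -> x ^+ 2 \in Q ->
    exists2 y, y \in Q :* x & y ^+ 2 = 1.

Section PartialTransversals.

Variables (gT : finGroupType) (G Q : {group gT}).

Implicit Types (S B D : {set gT}) (x y z a b : gT).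

(** Boolean, so that one of maximal cardinality can be chosen.  Elements of [S]
    represent their right cosets, and the union of the represented cosets is
    [Q * S]. *)
Definition partial_transversal S :=
  [&& S \subset G :\: Q, S^-1 == S
    & [forall s in S, forall t in S, (s * t^-1 \in Q) ==> (s == t)]].

Lemma partial_transversalP S :
  reflect [/\ S \subset G :\: Q, S^-1 = S
            & {in S &, forall s t, s * t^-1 \in Q -> s = t}]
          (partial_transversal S).
Proof.
apply: (iffP and3P) => [[sS /eqP SV injS] | [sS SV injS]]; split=> //.
- move=> s t sS' tS stQ; apply/eqP.
  by have /implyP/(_ stQ) := forall_inP (forall_inP injS _ sS') _ tS.
- exact/eqP.
apply/forall_inP=> s sS'; apply/forall_inP=> t tS; apply/implyP=> stQ.
by rewrite (injS s t).
Qed.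

Lemma mem_mul_coset S x :
  reflect (exists2 s, s \in S & x * s^-1 \in Q) (x \in Q * S).
Proof.
apply: (iffP mulsgP) => [[q s qQ sS ->] | [s sS xsQ]].
  by exists s; rewrite ?mulgK.
by exists (x * s^-1) s; rewrite ?mulgKV.
Qed.

Lemma mem_mul_same_coset S a b :
  a * b^-1 \in Q -> (a \in Q * S) = (b \in Q * S).
Proof.
move=> abQ; have E s : a * s^-1 = (a * b^-1) * (b * s^-1).
  by rewrite mulgA mulgKV.
by apply/mem_mul_coset/mem_mul_coset=> -[s sS usQ]; exists s => //;
  move: usQ; rewrite E (groupMl _ abQ).
Qed.

Lemma card_mul_inj S :
  {in S &, forall s t, s * t^-1 \in Q -> s = t} -> #|Q * S| = (#|Q| * #|S|)%N.
Proof.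
move=> injS; rewrite -cardsX [Q * S]curry_imset2X card_in_imset //.
move=> [q s] [r t]; rewrite !inE /= => /andP[qQ sS] /andP[rQ tS] E.
have st: s = t.
  apply: injS => //; have -> : s = q^-1 * (r * t) by rewrite -E mulKg.
  by rewrite -!mulgA mulgV mulg1 groupM ?groupV.
by move: E; rewrite st => /mulIg ->.
Qed.

(** Elements that differ from their inverse come in pairs. *)
Lemma odd_inv_closed B : B^-1 = B -> odd #|B| -> exists2 y, y \in B & y^-1 = y.
Proof.
have [n] := ubnP #|B|; elim: n B => // n IHn B ltB BV oddB.
have [y yB]: exists y, y \in B.
  by apply/set0Pn; case: eqP oddB => // ->; rewrite cards0.
have yVB: y^-1 \in B by rewrite -mem_invg BV.
have [yV | yV] := eqVneq y^-1 y; first by exists y.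
pose B' := (B :\ y) :\ y^-1.
have cB: #|B| = #|B'|.+2.
  by rewrite (cardsD1 y) yB (cardsD1 y^-1) !inE yV yVB.
have [||| z] := IHn B'; last by rewrite !inE => /and3P[_ _ zB] zV; exists z.
- by rewrite cB ltnS in ltB; apply: ltnW.
- apply/setP=> z; rewrite !inE (inj_eq invg_inj) andbCA eq_invg_sym.
  by rewrite -mem_invg BV.
- by move: oddB; rewrite cB /= negbK.
Qed.

(** The last hypothesis covers both ways of extending: when [z ^+ 2] is outside
    [Q], the elements [z] and [z^-1] represent distinct cosets; otherwise they
    share a coset and have to be equal. *)
Lemma extend_transversal S z :
    partial_transversal S -> z \in G :\: Q ->
    z \notin Q * S -> z^-1 \notin Q * S -> (z^+2 \in Q -> z^-1 = z) ->
  partial_transversal (z |: (z^-1 |: S)).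
Proof.
case/partial_transversalP=> sS SV injS /[!inE] /andP[zQ zG] zS zVS z2.
apply/partial_transversalP; split.
- by rewrite !subUset !sub1set !inE !groupV zQ zG sS.
- apply/setP=> x; rewrite !inE (inj_eq invg_inj) eq_invg_sym orbCA.
  by rewrite -mem_invg SV.
have nS u v: u \notin Q * S -> v \in S -> u * v^-1 \in Q -> u = v.
  by move=> uS vS uvQ; case/mem_mul_coset: uS; exists v.
have nS' u v: u \notin Q * S -> v \in S -> v * u^-1 \in Q -> v = u.
  by move=> uS vS; rewrite -groupV invMg invgK => /(nS _ _ uS vS).
have nV: z^-1 * z^-1 \in Q -> z = z^-1.
  by rewrite -groupV invMg invgK -expg2 => /z2.
move=> s t; rewrite !inE.
case/or3P=> [/eqP->|/eqP->|sS']; case/or3P=> [/eqP->|/eqP->|tS] //;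
  rewrite ?invgK -?expg2 ?expgVn ?groupV; try by auto.
- by move/z2.
- by rewrite -{1}[z]invgK; apply: nS'.
Qed.

(** The last hypothesis says that the coset of [a] meets the inverse of the
    coset of [b]; an element [z] of the intersection represents the first coset
    while [z^-1] represents the second one. *)
Lemma pair_cosets S a b :
    Q \subset G -> partial_transversal S -> a \in G :\: Q -> b \in G :\: Q ->
    a \notin Q * S -> b \notin Q * S -> a * b^-1 \notin Q ->
    b \in Q * [set a^-1] * Q ->
  exists2 S', partial_transversal S' & #|S'| = #|S|.+2.
Proof.
move=> sQG tS /[!inE] /andP[aQ aG] _ aS bS abQ.
case/mulsgP=> _ r /mulsgP[q _ qQ /set1P-> ->] rQ def_b.
pose z := r^-1 * a.
have zS: z \notin Q * S by rewrite (@mem_mul_same_coset _ _ a) // mulgK groupV.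
have zV: z^-1 = q^-1 * b by rewrite def_b invMg invgK -!mulgA mulKg.
have zVS: z^-1 \notin Q * S.
  by rewrite zV (@mem_mul_same_coset _ _ b) // mulgK groupV.
have z2: z * z \notin Q.
  apply: contra abQ => z2Q; rewrite -[a](mulKVg r) -/z.
  by rewrite -[b](mulKVg q) -zV invMg invgK mulgA groupM ?groupV // -mulgA groupM.
have zGQ: z \in G :\: Q.
  by rewrite !inE groupMl ?groupV // aQ groupM ?groupV // (subsetP sQG).
exists (z |: (z^-1 |: S)).
  by apply: extend_transversal; rewrite // expg2 (negPf z2).
have zS' u : u \notin Q * S -> u \notin S.
  exact: contra (subsetP (mulG_subr Q S) u).
have zNV: z != z^-1 by apply: contra z2 => /eqP{2}->; rewrite mulgV.
by rewrite !cardsU1 !inE negb_or zNV !zS'.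
Qed.

Lemma sub_transversal S y :
    partial_transversal S -> y^-1 = y -> partial_transversal (S :\ y).
Proof.
case/partial_transversalP=> sS SV injS yV; apply/partial_transversalP; split.
- exact: subset_trans (subsetDl _ _) sS.
- by apply/setP=> x; rewrite !inE eq_invg_sym yV -mem_invg SV.
by move=> s t /setD1P[_ sS'] /setD1P[_ tS]; apply: injS.
Qed.

(** The covered part of [D] is the union of the cosets of the elements of
    [S :&: D], because [D] is a union of right cosets. *)
Lemma card_uncovered S D :
    Q * D = D -> {in S &, forall s t, s * t^-1 \in Q -> s = t} ->
  (#|D :\: (Q * S)%g| + #|Q| * #|S :&: D|)%N = #|D|.
Proof.
move=> QD injS.
rewrite -card_mul_inj; last first.
  by move=> s t /setIP[sS _] /setIP[tS _]; apply: injS.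
rewrite addnC -(cardsID (Q * S) D); congr (#|pred_of_set _| + _)%N.
apply/setP=> x; rewrite inE; apply/mem_mul_coset/andP.
  case=> s /setIP[sS sD] xsQ; split; last by apply/mem_mul_coset; exists s.
  by rewrite -QD -[x](mulgKV s) mem_mulg.
case=> xD /mem_mul_coset[s sS xsQ]; exists s => //; rewrite inE sS.
by rewrite -QD -[s](mulgKV x) mem_mulg // -groupV invMg invgK.
Qed.

(** Up to translation [QxQ] is the product of [Q] and a conjugate, so that it
    consists of [#|Q : Q :&: Q :^ x^-1|] right cosets: a power of 2, and odd
    only if it is 1. *)
Lemma odd_double_coset x n :
    2.-group Q -> odd n -> #|Q * [set x] * Q| = (#|Q| * n)%N ->
  x \in 'N(Q).
Proof.
move=> Q2 oddn cD.
have cD': #|Q * (Q :^ x^-1)| = (#|Q| * n)%N.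
  rewrite -cD -(card_rcoset (Q * Q :^ x^-1) x); congr #|pred_of_set _|.
  by rewrite conjsgE invgK -!mulgA mulg_set1 mulVg mulg1.
have := mul_cardG Q (Q :^ x^-1).
rewrite cD' cardJg -mulnA => /eqP; rewrite eqn_pmul2l ?cardG_gt0 // => /eqP cI.
have n1: n = 1%N.
  have n_nat: 2.-nat n by apply: pnat_dvd Q2; rewrite cI dvdn_mulr.
  by have [[|k] nE] := p_natP n_nat; rewrite nE // oddX in oddn *.
rewrite n1 mul1n in cI.
by rewrite inE sub_conjg; apply/setIidPl/eqP; rewrite eqEcard subsetIl -cI /=.
Qed.

(** The maximality argument: if the coset of [x] is missed, then the double
    coset of [x] must be a single self-inverse coset, where an element of
    square 1 is available. *)
Lemma exists_full_transversal :
    Q \subset G -> 2.-group Q -> involutions_lift G Q ->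
  exists2 S, partial_transversal S & G :\: Q \subset Q * S.
Proof.
move=> sQG Q2 lift.
have t0: partial_transversal set0.
  apply/partial_transversalP; split; first exact: sub0set.
    by apply/setP=> x; rewrite !inE.
  by move=> s t; rewrite inE.
case: (@arg_maxnP _ _ partial_transversal (fun S => #|S|) t0) => S tS maxS.
exists S => //; apply/subsetP=> x xGQ; apply/idPn=> xS.
have [sS SV injS] := partial_transversalP _ tS.
pose D := Q * [set x] * Q.
have DV : D^-1 = Q * [set x^-1] * Q.
  by rewrite /D !invMg invGid invg_set1 mulgA.
have QD : Q * D = D by rewrite /D !mulgA mulGid.
have QDV : Q * D^-1 = D^-1 by rewrite DV !mulgA mulGid.
have xD : x \in D by rewrite -[x]mul1g -[1 * x]mulg1 !mem_mulg ?set11.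
have DGQ b : b \in D^-1 -> b \in G :\: Q.
  rewrite DV => /mulsgP[_ r /mulsgP[q _ qQ /set1P-> ->] rQ ->].
  have [xG xQ] := setDP xGQ.
  rewrite inE (groupMr _ rQ) (groupMl _ qQ) groupV xQ.
  by rewrite !groupM ?groupV // (subsetP sQG).
(* One element of S may be given up first, since a pair is gained. *)
have no_pair S' b :
    partial_transversal S' -> S' \subset S -> #|S| <= #|S'|.+1 ->
    b \in D^-1 -> b \notin Q * S' -> x * b^-1 \in Q.
  move=> tS' sS' cS' bD bS'; apply/idPn=> xb.
  have xS' : x \notin Q * S' by apply: contra xS; apply/subsetP/mulgS.
  have bGQ := DGQ b bD; rewrite DV in bD.
  have [S2 /maxS le2 c2] := pair_cosets sQG tS' xGQ bGQ xS' bS' xb bD.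
  by move: (leq_trans le2 cS'); rewrite c2 ltnn.
have DxV b : b \in D^-1 -> x * b^-1 \in Q -> x \in D^-1.
  by move=> bD xb; rewrite -QDV -[x](mulgKV b) mem_mulg.
have cU := card_uncovered QD injS; have cUV := card_uncovered QDV injS.
have cSD : #|S :&: D^-1| = #|S :&: D| by rewrite -{1}SV -invIg card_invg.
have unc b : b \in D^-1 -> b \notin Q * S -> x * b^-1 \in Q.
  by apply: no_pair.
(* Inversion matches the sizes of D and D^-1 and of their covered parts, so
   D^-1 has a missed coset because D has one. *)
have xDV : x \in D^-1.
  have : 0 < #|D^-1 :\: Q * S|.
    rewrite -(ltn_add2r (#|Q| * #|S :&: D|)) -{2}cSD cUV card_invg -cU.
    by rewrite ltn_add2r; apply/card_gt0P; exists x; rewrite inE xS xD.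
  by case/card_gt0P=> b /setDP[bD bS]; apply: DxV bD (unc b bD bS).
have DVD : D^-1 = D.
  apply/esym/eqP; rewrite eqEcard card_invg leqnn andbT.
  have <- : Q * D^-1 * Q = D^-1 by rewrite QDV DV -mulgA mulGid.
  by rewrite mulSg // mulgS // sub1set.
(* The coset of x is the only one that S misses in D. *)
have cD : #|D| = (#|Q| * #|S :&: D|.+1)%N.
  rewrite -cU mulnS; congr (_ + _)%N; rewrite -(card_rcoset Q x).
  congr #|pred_of_set _|; apply/setP=> b; rewrite mem_rcoset inE.
  apply/andP/idP => [[bS bD] | bxQ].
    by rewrite -groupV invMg invgK unc ?DVD.
  split; last by rewrite -QD -[b](mulgKV x) mem_mulg.
  by rewrite (mem_mul_same_coset S bxQ).
(* A self-inverse y in S could be traded for a pair covering the cosets of x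
   and y. *)
have evenSD : ~~ odd #|S :&: D|.
  apply/negP=> /odd_inv_closed[|y /setIP[yS yD] yV].
    by rewrite invIg SV DVD.
  have xy: x * y^-1 \in Q.
    apply: (no_pair (S :\ y)); rewrite ?DVD ?sub_transversal ?subsetDl //.
      by rewrite (cardsD1 y S) yS.
    apply/mem_mul_coset=> -[s /setD1P[/eqP sy sS'] ysQ]; case: sy.
    by rewrite (injS y s).
  by case/mem_mul_coset: xS; exists y.
have xN : x \in 'N(Q) by apply: odd_double_coset Q2 _ cD.
have DQx : D = Q :* x.
  have /normC xQ : [set x] \subset 'N(Q) by rewrite sub1set.
  by rewrite /D -mulgA xQ mulgA mulGid.
have x2 : x ^+ 2 \in Q.
  have : x^-1 \in Q :* x by rewrite -DQx -DVD mem_invg invgK.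
  by rewrite mem_rcoset -invMg groupV expg2.
have [|y yQx y2] := lift x _ x2; first by rewrite inE xN; case/setDP: xGQ => ->.
have yD : y \in D^-1 by rewrite DVD DQx.
have yS : y \notin Q * S.
  by rewrite mem_rcoset in yQx; rewrite (mem_mul_same_coset S yQx).
have yV : y^-1 = y by apply/eqP; rewrite eq_invg_mul -expg2 y2.
have /maxS : partial_transversal (y |: (y^-1 |: S)).
  by apply: extend_transversal; rewrite ?yV // DGQ.
rewrite yV setUA setUid cardsU1.
by rewrite (contra (subsetP (mulG_subr Q S) y) yS) /= ltnn.
Qed.

End PartialTransversals.

(** * Perfect codes and lifting of involutions *)

Lemma perfect_code_of_transversal (gT : finGroupType) (G Q : {group gT}) S :
    Q \subset G -> partial_transversal G Q S -> G :\: Q \subset Q * S ->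
  perfect_code_of G Q.
Proof.
move=> sQG /partial_transversalP[sS SV injS] fullS; exists S; split.
  split=> //; apply: subset_trans sS _; apply/subsetP=> x; rewrite !inE.
  by case/andP=> xQ ->; rewrite andbT; apply: contraNneq xQ => ->; apply: group1.
split=> // [x y xQ yQ | v /setDP[vG vQ]].
  rewrite /Cayley_adj; apply/negP=> /(subsetP sS).
  by rewrite !inE groupMl ?groupV // xQ.
have /(subsetP fullS)/mulsgP[q s qQ sS' vE]: v^-1 \in G :\: Q.
  by rewrite !inE !groupV vQ vG.
exists q^-1; split; first by rewrite groupV /Cayley_adj vE mulKg.
move=> c [cQ]; rewrite /Cayley_adj vE => cS.
have := injS _ _ cS sS'; rewrite mulgA mulgK groupM // => /(_ isT) /eqP.
by rewrite -{2}[s]mul1g (inj_eq (mulIg s)) -eq_invg_mul => /eqP<-; rewrite invgK.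
Qed.

(** The coset [Q :* x] is inverse-closed since [x] normalises [Q] and
    [x ^+ 2 \in Q].  If it is not [Q], its unique element in the connection set
    therefore equals its own inverse. *)
Lemma perfect_code_sqr (gT : finGroupType) (G Q : {group gT}) x :
    perfect_code_of G Q -> x \in 'N_G(Q) -> x ^+ 2 \in Q ->
  exists2 y, y \in Q :* x & y ^+ 2 = 1.
Proof.
case=> S [[sS SV] [sQG indep perfect]] /setIP[xG xN] x2Q.
have [xQ | xQ] := boolP (x \in Q).
  by exists 1; rewrite ?expg1n // rcoset_id.
have [|c [[cQ cS] c_uniq]] := perfect x^-1; first by rewrite !inE !groupV xQ.
move: cS c_uniq; rewrite /Cayley_adj invgK => cS c_uniq.
(* By uniqueness, c * x is its own inverse as soon as its inverse also lies in
   the connection set and in the coset of x. *)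
exists (c * x); first by rewrite mem_rcoset mulgK.
have cx: c * x * c = x^-1 -> (c * x)^+2 = 1.
  by rewrite expg2 mulgA => ->; rewrite mulVg.
have: c = (c * x)^-1 * x^-1.
  apply: c_uniq; rewrite mulgKV -mem_invg SV; split=> //.
  have xcx : x * (c * x) = x ^+ 2 * c ^ x by rewrite expg2 conjgE !mulgA mulgK.
  by rewrite -invMg groupV xcx groupM ?memJ_norm.
by move=> E; apply: cx; rewrite {2}E mulKVg.
Qed.

(** If [v \in P] and [c \in Q], then [c * v^-1 \in P]: no edge between [P] and
    [Q] is lost when the connection set is intersected with [P]. *)
Lemma perfect_code_sub (gT : finGroupType) (G P Q : {group gT}) :
  Q \subset P -> P \subset G -> perfect_code_of G Q -> perfect_code_of P Q.
Proof.
move=> sQP sPG [S [[sS SV] [sQG indep perfect]]]; exists (S :&: P); split.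
  split; last by rewrite invIg SV invGid.
  by move: sS; rewrite !subsetD1 subsetIr inE => /andP[_ /negPf->].
split=> // [x y xQ yQ | v /setDP[vP vQ]].
  by apply: contra (indep x y xQ yQ) => /setIP[].
have [|c [[cQ cS] c_uniq]] := perfect v; first by rewrite inE vQ (subsetP sPG).
exists c; split=> [|d [dQ /setIP[dS _]]]; last exact: c_uniq.
rewrite /Cayley_adj in cS *; split=> //.
by rewrite inE cS groupM ?groupV // (subsetP sQP).
Qed.

Lemma perfect_code_2groupP (gT : finGroupType) (G Q : {group gT}) :
    Q \subset G -> 2.-group Q ->
  perfect_code_of G Q <-> involutions_lift G Q.
Proof.
move=> sQG Q2; split=> [pcQ x | lift]; first exact: perfect_code_sqr.
have [S] := exists_full_transversal sQG Q2 lift.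
exact: perfect_code_of_transversal.
Qed.

(** * Reduction to Sylow 2-subgroups *)

Lemma pgroup_adjoin_root (gT : finGroupType) (Q : {group gT}) p x :
    prime p -> p.-group Q -> x \in 'N(Q) -> x ^+ p \in Q ->
  p.-group (Q <*> <[x]>).
Proof.
move=> p_pr pQ xN xpQ; rewrite norm_joinEr ?cycle_subG // pgroupM pQ /=.
have: #[x] %| p * #|Q| by rewrite order_dvdn expgM expg_cardG.
by move/pnat_dvd; apply; rewrite pnatM pnat_id.
Qed.

Theorem theorem4p1 (gT : finGroupType) (G : {group gT}) :
  (forall Q : {group gT}, Q \subset G -> 2.-group Q ->
     (perfect_code_of G Q <->
      forall P : {group gT}, 2.-Sylow(G) P -> Q \subset P ->
        perfect_code_of P Q))
  /\
  (forall P Q : {group gT}, 2.-Sylow(G) P -> Q <| P ->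
     (perfect_code_of G Q <-> perfect_code_of P Q)).
Proof.
split=> [Q sQG Q2 | P Q sylP nQP].
  split=> [pcQ P sylP sQP | pcP].
    exact: perfect_code_sub (pHall_sub sylP) pcQ.
  apply/perfect_code_2groupP=> // x xNG x2.
  have [xG xN] := setIP xNG.
  have [||P sylP] := @Sylow_superset 2 _ G (Q <*> <[x]>).
  - by rewrite join_subG sQG cycle_subG.
  - exact: pgroup_adjoin_root.
  rewrite join_subG cycle_subG => /andP[sQP xP].
  by apply: (perfect_code_sqr (pcP P sylP sQP)); rewrite // inE xP.
have [sQP nQP'] := andP nQP; have sPG := pHall_sub sylP.
have Q2 := pgroupS sQP (pHall_pgroup sylP).
split=> [|pcP]; first exact: perfect_code_sub.
apply/perfect_code_2groupP=> // [|x /setIP[xG xN] x2].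
  exact: subset_trans sPG.
(* A conjugating element can be chosen in 'N_G(Q), hence fixing Q. *)
have sylPN: 2.-Sylow('N_G(Q)) P.
  by apply: pHall_subl sylP; rewrite ?subsetIl // subsetI sPG.
have [||n /setIP[nG nN]] := Sylow_Jsub sylPN (Q := <[x]>%G).
- by rewrite cycle_subG inE xG.
- have := @pgroup_adjoin_root _ Q 2 x isT Q2 xN x2.
  by apply: pgroupS; apply: joing_subr.
rewrite -cycleJ cycle_subG => xnP.
have [||y yQ y2] := perfect_code_sqr (x := x ^ n) pcP.
- by rewrite inE xnP groupJ.
- by rewrite -conjXg memJ_norm.
exists (y ^ n^-1); last by rewrite -conjXg y2 conj1g.
by rewrite mem_rcoset -(memJ_norm _ nN) conjMg conjVg conjgKV -mem_rcoset.
Qed.
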